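(* Let $A$ be a semi-hereditary ring. If every minimal prime ideal of $A$ is finitely generated, then $A$ is (isomorphic to) a finite direct product of Prüfer domains.
   Context: All rings are commutative with identity. A ring $A$ is called semi-hereditary if every finitely generated ideal of $A$ is projective as an $A$-module. An integral domain $D$ is called a Prüfer domain if for every prime ideal $\mathfrak{p}$ of $D$ the localization $D_{\mathfrak{p}}$ is a valuation ring. The zero ring is regarded as the empty product. *)

(* Defs.v *)
From HB Require Import structures.
From mathcomp Require Import all_boot all_algebra.
From mathcomp Require Import boolp.

Set Implicit Arguments.
Unset Strict Implicit.
Unset Printing Implicit Defensive.

Local Notation tofrac := (@FracField.tofrac _).

Import GRing.Theory.
Local Open Scope ring_scope.

(* [comPzRingType] is used for rings since the zero ring is allowed.  The
   ideals of ring_quotient.v are proper ideals of nonzero rings; here an ideal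
   is a submodule of the regular module, the unit ideal included. *)
Definition ideal (A : comPzRingType) : Type := submodClosed A^o.

Definition in_ideal (A : comPzRingType) (I : ideal A) : {pred A} :=
  fun x => x \in (I : {pred A^o}).
Coercion in_ideal : ideal >-> pred_sort.

Definition ideal_module (A : comPzRingType) (I : ideal A) : Type :=
  {x : A^o | x \in (I : {pred A^o})}.
HB.instance Definition _ (A : comPzRingType) (I : ideal A) :=
  SubChoice.on (ideal_module I).
HB.instance Definition _ (A : comPzRingType) (I : ideal A) :=
  [SubChoice_isSubLmodule of ideal_module I by <:].

Definition finitely_generated (A : comPzRingType) (I : ideal A) : Prop :=
  exists (n : nat) (g : 'I_n -> A), forall x : A,
    x \in I <-> exists c : 'I_n -> A, x = \sum_(i < n) c i * g i.

Definition projective (A : comPzRingType) (P : lmodType A) : Prop :=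
  forall (M N : lmodType A) (g : {linear M -> N}) (f : {linear P -> N}),
    (forall y : N, exists x : M, g x = y) ->
    exists h : {linear P -> M}, forall p : P, g (h p) = f p.

Definition semi_hereditary (A : comPzRingType) : Prop :=
  forall I : ideal A, finitely_generated I -> projective (ideal_module I).

Definition prime_ideal (A : comPzRingType) (p : ideal A) : Prop :=
  1 \notin p /\
  forall a b : A, a * b \in p -> a \in p \/ b \in p.

Definition minimal_prime (A : comPzRingType) (p : ideal A) : Prop :=
  prime_ideal p /\
  forall q : ideal A, prime_ideal q ->
    {subset q <= p} -> {subset p <= q}.

(* The localization at [p] of a domain, as a subset of the fraction field; it
   is a subring when [p] is prime. *)
Definition localization (D : idomainType) (p : ideal D) :
    {pred {fraction D}} :=
  fun x => `[< exists a s : D, s \notin p /\ x = tofrac a / tofrac s >].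

(* [V] is a valuation ring with fraction field [K]: the second condition forces
   [K] to be the fraction field of [V]. *)
Definition valuation_ring (K : fieldType) (V : {pred K}) : Prop :=
  GRing.subring_closed V /\
  forall x : K, x != 0 -> x \in V \/ x^-1 \in V.

Definition prufer_domain (D : idomainType) : Prop :=
  forall p : ideal D, prime_ideal p -> valuation_ring (localization p).

(* The library has a ring structure on {ffun I -> R} only for a constant family
   of rings. *)
Section FiniteProduct.
Variables (I : finType) (R : I -> comPzRingType).
Local Notation prodR := {dffun forall i : I, R i}.
Implicit Types x y z : prodR.

Definition dffun_zero : prodR := [ffun i => 0 : R i].
Definition dffun_opp x : prodR := [ffun i => - x i].
Definition dffun_add x y : prodR := [ffun i => x i + y i].
Definition dffun_one : prodR := [ffun i => 1 : R i].
Definition dffun_mul x y : prodR := [ffun i => x i * y i].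

Fact dffun_addA : associative dffun_add.
Proof. by move=> x y z; apply/ffunP=> i; rewrite !ffunE addrA. Qed.
Fact dffun_addC : commutative dffun_add.
Proof. by move=> x y; apply/ffunP=> i; rewrite !ffunE addrC. Qed.
Fact dffun_add0 : left_id dffun_zero dffun_add.
Proof. by move=> x; apply/ffunP=> i; rewrite !ffunE add0r. Qed.
Fact dffun_addN : left_inverse dffun_zero dffun_opp dffun_add.
Proof. by move=> x; apply/ffunP=> i; rewrite !ffunE addNr. Qed.

HB.instance Definition _ := GRing.isZmodule.Build prodR
  dffun_addA dffun_addC dffun_add0 dffun_addN.

Fact dffun_mulA : associative dffun_mul.
Proof. by move=> x y z; apply/ffunP=> i; rewrite !ffunE mulrA. Qed.
Fact dffun_mulC : commutative dffun_mul.
Proof. by move=> x y; apply/ffunP=> i; rewrite !ffunE mulrC. Qed.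
Fact dffun_mul1 : left_id dffun_one dffun_mul.
Proof. by move=> x; apply/ffunP=> i; rewrite !ffunE mul1r. Qed.
Fact dffun_mulD : left_distributive dffun_mul dffun_add.
Proof. by move=> x y z; apply/ffunP=> i; rewrite !ffunE mulrDl. Qed.

HB.instance Definition _ := GRing.Zmodule_isComPzRing.Build prodR
  dffun_mulA dffun_mulC dffun_mul1 dffun_mulD.
End FiniteProduct.

(* Main.v *)
(* Splitting the free module over a finitely generated projective ideal shows
   that annihilators of elements are generated by idempotents.  Hence, for a
   prime ideal m, the elements fixed by some idempotent of m form a prime ideal,
   which is the only minimal prime inside m; being finitely generated, it is
   generated by one idempotent e, so (1 - e) A is a domain.  Distinct such
   idempotents 1 - e are orthogonal, and they lie in no common prime m, since m
   would then contain both e and 1 - e: thus finitely many of them sum to 1.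
   On a domain factor, splitting an ideal (x, y) gives x = a x + b y and
   y = c x + d y with y a = x c and y b = x d, whence a + d = 1: one of a and d
   is a unit at each prime, and y / x = c / a, x / y = b / d. *)
From HB Require Import structures.
Require Import Defs.
From mathcomp Require Import all_boot all_algebra.
From mathcomp Require Import boolp classical_sets.
From mathcomp Require Import generic_quotient.
From mathcomp Require Import ring.

Set Implicit Arguments.
Unset Strict Implicit.
Unset Printing Implicit Defensive.

Import GRing.Theory.
Local Open Scope ring_scope.

Local Notation tofrac := (@FracField.tofrac _).

(** * Ideals given by predicates, and primes above proper ideals *)

Section IdealOfProp.
Variables (A : comPzRingType) (P : A -> Prop).
Hypothesis P0 : P 0.
Hypothesis PD : forall a x y : A, P x -> P y -> P (a * x + y).

(* The unused proofs are arguments so that the instance below can be keyed on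
   this predicate. *)
Definition prop_pred of P 0 & (forall a x y : A, P x -> P y -> P (a * x + y)) :
  {pred A^o} := fun x => `[< P x >].

Fact prop_pred_submod : submod_closed (prop_pred P0 PD).
Proof.
split; first exact/asboolP.
by move=> a x y /asboolP Px /asboolP Py; apply/asboolP/PD.
Qed.

HB.instance Definition _ :=
  GRing.isSubmodClosed.Build A A^o (prop_pred P0 PD) prop_pred_submod.

Definition ideal_of_prop : ideal A := (prop_pred P0 PD : submodClosed A^o).

Lemma ideal_of_propP (x : A) : x \in ideal_of_prop <-> P x.
Proof. by split=> /asboolP. Qed.

End IdealOfProp.

Section Ideals.
Variable A : comPzRingType.
Implicit Types (I p q : ideal A) (x y a : A).

Lemma ideal0 I : 0 \in I.
Proof. exact: (@rpred0 A^o I). Qed.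

Lemma idealD I x y : x \in I -> y \in I -> x + y \in I.
Proof. exact: (@rpredD A^o I). Qed.

Lemma idealMl I a x : x \in I -> a * x \in I.
Proof. exact: (@rpredZ A A^o I a x). Qed.

Lemma idealN1 p a : prime_ideal p -> a \in p -> 1 - a \notin p.
Proof.
move=> [p1 _] ap; apply/negP => ap'.
by move: p1; rewrite -(subrK a 1) idealD.
Qed.

(* A maximal element, in Zorn's lemma, among the proper ideals over [I]; the
   empty set is admitted so that the empty chain has an upper bound. *)
Lemma prime_above I : 1 \notin I ->
  exists2 p : ideal A, prime_ideal p & {subset I <= p}.
Proof.
move=> I1.
pose P (X : set A) := [/\ forall a x y, X x -> X y -> X (a * x + y), ~ X 1
  & forall x y, X x -> y \in I -> X y].
have [F FP tot|X [[Xlin X1 XI] Xmax]] := @Zorn_bigcup A P.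
  split.
  - move=> a x y [X FX Xx] [Y FY Yy].
    have [[Xlin _ _] [Ylin _ _]] := (FP _ FX, FP _ FY).
    case: (tot _ _ FX FY) => XY; first by exists Y; last exact: Ylin _ _ _ (XY _ Xx) Yy.
    by exists X; last exact: Xlin _ _ _ Xx (XY _ Yy).
  - by case=> X /FP[_ X1 _].
  - by move=> x y [X FX Xx] Iy; exists X => //; have [_ _ XI] := FP _ FX; exact: XI Xx Iy.
(* A maximal [X] missing 0 would be empty, as a nonempty one contains [I]; then [I] itself would be
   strictly larger. *)
have X0 : X 0.
  apply: contrapT => X0.
  have nX y : ~ X y by move=> Xy; apply: X0; apply: XI Xy _; apply: ideal0.
  apply: (Xmax (fun x => x \in I)).
    by split=> [y /nX //|/(_ 0 (ideal0 I))].
  split=> [a x y xI yI|/(negP I1) //|//].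
  by apply: idealD => //; apply: idealMl.
have IX x : x \in I -> X x by move=> xI; apply: XI X0 _.
exists (ideal_of_prop X0 Xlin) => [|x xI]; last exact/ideal_of_propP/IX.
split=> [|a b /ideal_of_propP Xab]; first by apply/negP => /ideal_of_propP.
suff [Xa|Xb] : X a \/ X b; first by left; apply/ideal_of_propP.
  by right; apply/ideal_of_propP.
apply: contrapT => /not_orP[Xa Xb].
(* This is [X + aA]. By maximality it contains 1, and multiplying [1 = x + r * a] by [b] puts [b] in
   [X]. *)
pose Y : set A := fun z => exists x r, X x /\ z = x + r * a.
suff [x [r [Xx e1]]] : Y 1.
  apply: Xb; have -> : b = b * x + (r * (a * b) + 0) by rewrite -[LHS]mulr1 e1; ring.
  by apply: (Xlin _ _ _ Xx); exact: Xlin.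
apply: contrapT => Y1; apply: (Xmax Y).
  split=> [x Xx|/(_ a) YX]; first by exists x, 0; split=> //; ring.
  by apply: Xa; apply: YX; exists 0, 1; split=> //; ring.
split=> // [c _ _ [x [r [Xx ->]]] [y [s [Xy ->]]]|_ y _ yI].
  by exists (c * x + y), (c * r + s); split; [apply: Xlin|ring].
by exists y, 0; split; [apply: IX|ring].
Qed.

End Ideals.

(** * Splittings, annihilators and minimal primes in a semi-hereditary ring *)

Section SemiHereditary.
Variable A : comPzRingType.
Hypothesis hA : semi_hereditary A.
Implicit Types (I p q : ideal A) (x y a : A).

Section Splitting.
Variables (n : nat) (g : 'I_n -> A).

Definition in_span x := exists c : 'I_n -> A, x = \sum_(i < n) c i * g i.

Fact in_span0 : in_span 0.
Proof. by exists (fun=> 0); rewrite big1 // => i _; rewrite mul0r. Qed.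

Fact in_spanD a x y : in_span x -> in_span y -> in_span (a * x + y).
Proof.
move=> [c ->] [d ->]; exists (fun i => a * c i + d i).
by rewrite mulr_sumr -big_split; apply: eq_bigr => i _ /=; ring.
Qed.

Definition span : ideal A := ideal_of_prop in_span0 in_spanD.

Fact comb_in_span (v : 'rV[A]_n) :
  \sum_(i < n) v 0 i * g i \in (span : {pred A^o}).
Proof. by apply/(ideal_of_propP in_span0 in_spanD); exists (v 0). Qed.

Definition span_comb (v : 'rV[A]_n) : ideal_module span :=
  Sub (\sum_(i < n) v 0 i * g i : A^o) (comb_in_span v).

Lemma val_span_comb v : \val (span_comb v) = \sum_i v 0 i * g i :> A.
Proof. exact: SubK. Qed.

Fact span_comb_linear : linear span_comb.
Proof.
move=> a u v; apply: val_inj; rewrite [LHS]val_span_comb.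
transitivity (a * \val (span_comb u) + \val (span_comb v) : A) => //.
rewrite !val_span_comb mulr_sumr -big_split; apply: eq_bigr => i _ /=.
by rewrite !mxE; ring.
Qed.

HB.instance Definition _ :=
  GRing.isLinear.Build A 'rV[A]_n (ideal_module span) *:%R span_comb
    span_comb_linear.

(* [c] is the matrix of a section of the projection of the free module on
   the generators [g] onto the ideal they span. *)
Lemma split_span : exists c : 'I_n -> 'I_n -> A,
  (forall i, g i = \sum_j c i j * g j) /\
  (forall r : 'I_n -> A, \sum_i r i * g i = 0 ->
     forall j, \sum_i r i * c i j = 0).
Proof.
have fg : finitely_generated span.
  by exists n, g => x; exact: (ideal_of_propP in_span0 in_spanD).
(* The section [h] lifts the identity of the span through the surjection [span_comb]. *)
have [y|h hK] := hA fg (g := span_comb) idfun.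
  have /(ideal_of_propP in_span0 in_spanD)[c yE] := valP y.
  exists (\row_i c i); apply: val_inj; rewrite [LHS]val_span_comb yE.
  by apply: eq_bigr => i _; rewrite mxE.
pose e i : ideal_module span := span_comb (delta_mx 0 i).
have eE i : val (e i) = g i :> A.
  rewrite val_span_comb (bigD1 i) //= big1 => [|j ji]; rewrite !mxE !eqxx ?mul1r ?addr0//.
  by rewrite (negbTE ji) mul0r.
exists (fun i j => h (e i) 0 j); split=> [i|r r0 j].
  by rewrite -[RHS](val_span_comb (h (e i))) hK eE.
have : h (\sum_i r i *: e i) = 0.
  suff -> : \sum_i r i *: e i = 0 by rewrite linear0.
  apply: val_inj; rewrite !raddf_sum /= -[RHS]r0; apply: eq_bigr => i _.
  by rewrite -eE.
rewrite linear_sum => /matrixP/(_ 0 j); rewrite summxE mxE => r0'.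
by rewrite -[RHS]r0'; apply: eq_bigr => i _; rewrite linearZ mxE.
Qed.

End Splitting.

(** With one generator, the splitting is a scalar [c] with [c * a = a] and [b * c = 0] whenever
    [b * a = 0]. Taking [b = 1 - c] shows that [1 - c] is idempotent. *)
Lemma annihilator_idempotent a :
  exists e, [/\ e * e = e, e * a = 0 & forall b, b * a = 0 -> b = b * e].
Proof.
have [c [ca cann]] := split_span (fun _ : 'I_1 => a).
have {}ca : c 0 0 * a = a by rewrite [RHS](ca 0) big_ord1.
have {}cann b : b * a = 0 -> b * c 0 0 = 0.
  by move=> ba; have := cann (fun=> b); rewrite big_ord1 => /(_ ba 0); rewrite big_ord1.
have ea : (1 - c 0 0) * a = 0 by rewrite mulrBl ca mul1r subrr.
exists (1 - c 0 0); split=> [|//|b /cann bc].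
  by rewrite mulrBr mulr1 cann ?subr0.
by rewrite mulrBr bc mulr1 subr0.
Qed.

Section PrimeCore.
Variable m : ideal A.

(** For [m] prime, this describes the kernel of the localization map at [m]. *)
Definition in_core x := exists e, [/\ e \in m, e * e = e & x = x * e].

Fact in_core0 : in_core 0.
Proof. by exists 0; split; rewrite ?mulr0 ?ideal0. Qed.

(** The witness is the join [e + f - e * f] in the Boolean algebra of idempotents. *)
Lemma core_common e f : e \in m -> e * e = e -> f \in m -> f * f = f ->
  exists k, [/\ k \in m, k * k = k, e * k = e & f * k = f].
Proof.
move=> em ee fm ff; exists (e + (1 - e) * f); split.
- by apply: idealD => //; apply: idealMl.
(* The square is arranged so that idempotence can be applied by rewriting [e * e] and [f * f]. *)
- transitivity (e * e + (e - e * e) * f *+ 2 + (1 - e - (e - e * e)) * (f * f)); first by ring.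
  by rewrite ee ff; ring.
- by transitivity (e * e + (e - e * e) * f); [ring|rewrite ee; ring].
- by transitivity (e * f + (1 - e) * (f * f)); [ring|rewrite ff; ring].
Qed.

Fact in_coreD a x y : in_core x -> in_core y -> in_core (a * x + y).
Proof.
move=> [e [em ee xe]] [f [fm ff yf]].
have [k [km kk ek fk]] := core_common em ee fm ff.
by exists k; split=> //; rewrite mulrDl -mulrA [in RHS]xe [in RHS]yf -!mulrA ek fk -xe -yf.
Qed.

Definition core : ideal A := ideal_of_prop in_core0 in_coreD.

Lemma coreP x : x \in core <-> in_core x.
Proof. exact: ideal_of_propP. Qed.

Lemma core_sub : {subset core <= m}.
Proof. by move=> x /coreP[e [em _ ->]]; apply: idealMl. Qed.

Lemma idem_core e : e \in m -> e * e = e -> e \in core.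
Proof. by move=> em ee; apply/coreP; exists e. Qed.

Hypothesis mprime : prime_ideal m.

Lemma idem_prime p e : prime_ideal p -> e * e = e -> e \in p \/ 1 - e \in p.
Proof.
by move=> [_ pP] ee; apply: pP; rewrite mulrBr ee mulr1 subrr ideal0.
Qed.

(** If [e] fixes [a * b], then [b] kills [a * (1 - e)], so [b = b * f] with [f] generating that
    annihilator. Since [m] contains [f] or [1 - f], the core contains [b] or [a]. *)
Lemma core_prime : prime_ideal core.
Proof.
split=> [|a b /coreP[e [em ee abe]]].
  by apply/negP => /core_sub; apply/negP; case: mprime.
have [f [ff fa fann]] := annihilator_idempotent (a * (1 - e)).
have bf : b = b * f.
  by apply: fann; transitivity (a * b - a * b * e); [ring|rewrite -abe subrr].
have [fm|fm] := idem_prime mprime ff.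
  by right; rewrite bf; apply: idealMl; apply: idem_core.
left; have -> : a = a * e + a * (1 - e) * (1 - f).
  by transitivity (a - f * (a * (1 - e))); [rewrite fa subr0|ring].
apply: idealD; apply: idealMl; apply: idem_core => //.
by transitivity (1 - f *+ 2 + f * f); [ring|rewrite ff; ring].
Qed.

(** A prime [q] inside the core contains every idempotent [e] of [m]: otherwise [1 - e] would lie in
    [q], hence in [m] together with [e]. *)
Lemma core_minimal_prime : minimal_prime core.
Proof.
split=> [|q qprime qcore x /coreP[e [em ee ->]]]; first exact: core_prime.
apply: idealMl; have [//|/qcore/core_sub] := idem_prime qprime ee.
by move/negP: (idealN1 mprime em).
Qed.

(** Each generator is fixed by an idempotent of [m]; the join of these finitely many idempotents
    fixes the whole core. *)
Lemma fg_core_idempotent : finitely_generated core ->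
  exists e, [/\ e \in m, e * e = e & forall x, x \in core -> x * e = x].
Proof.
move=> [n [g gP]].
have gcore i : in_core (g i).
  apply/coreP/gP; exists (fun j => (j == i)%:R).
  rewrite (bigD1 i) //= eqxx mul1r big1 ?addr0 // => j /negbTE->.
  by rewrite mul0r.
have [e [em ee eg]] : exists e, [/\ e \in m, e * e = e &
    forall i, i \in enum 'I_n -> g i * e = g i].
  elim: (enum _) => [|i s [e [em ee eg]]].
    by exists 0; split; rewrite ?mulr0 ?ideal0.
  have [f [fm ff gf]] := gcore i.
  have [k [km kk ek fk]] := core_common em ee fm ff.
  exists k; split=> // j; rewrite inE => /predU1P[->|/eg <-].
    by rewrite gf -mulrA fk.
  by rewrite -mulrA ek.
exists e; split=> // x /gP[c ->]; rewrite mulr_suml.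
by apply: eq_bigr => i _; rewrite -mulrA eg ?mem_enum.
Qed.

End PrimeCore.
End SemiHereditary.

(** * Idempotents that cut out domains *)

(** Equivalently, [uA], with identity [u], is an integral domain. *)
Definition integral_idempotent (A : comPzRingType) (u : A) : Prop :=
  [/\ u != 0, u * u = u &
      forall x y, u * (x * y) = 0 -> u * x = 0 \/ u * y = 0].

Section IntegralIdempotents.
Variable A : comPzRingType.
Implicit Types (u v x y a : A) (s : seq A).

(** Since [v * (1 - v) = 0], integrality of [u] gives [u * v = 0] or [u = u * v]. By symmetry, a
    nonzero product would force [u = u * v = v]. *)
Lemma integral_idempotent_orthogonal u v :
  integral_idempotent u -> integral_idempotent v -> u != v -> u * v = 0.
Proof.
move=> [_ uu uP] [_ vv vP] /eqP uv.
have u0 : u * (v * (1 - v)) = 0 by rewrite mulrBr vv mulr1 subrr mulr0.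
have v0 : v * (u * (1 - u)) = 0 by rewrite mulrBr uu mulr1 subrr mulr0.
have [//|uv1] := uP _ _ u0.
have [|vu1] := vP _ _ v0; first by rewrite mulrC.
case: uv; apply: (@etrans _ _ (u * v)).
  by apply/eqP; rewrite -subr_eq0 -{1}[u]mulr1 -mulrBr uv1.
by apply/esym/eqP; rewrite -subr_eq0 [u * v]mulrC -{1}[v]mulr1 -mulrBr vu1.
Qed.

Definition integral_seq s := uniq s /\ {in s, forall u, integral_idempotent u}.

Lemma integral_seq_mul_sum s v : integral_seq s -> v \in s ->
  v * \sum_(u <- s) u = v.
Proof.
move=> [us sP] vs; have [_ vv _] := sP v vs.
rewrite (bigD1_seq v) //= mulrDr vv mulr_sumr big_seq_cond big1 ?addr0 //.
by move=> u /andP[/sP ? uv]; apply: integral_idempotent_orthogonal => //;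
  [exact: sP|rewrite eq_sym].
Qed.

Lemma integral_seq_fixed s s' x : integral_seq s' -> {subset s <= s'} ->
  x = x * \sum_(u <- s) u -> x = x * \sum_(u <- s') u.
Proof.
move=> s'P ss' xs; rewrite {2}xs -mulrA mulr_suml {1}xs; congr (x * _).
rewrite [LHS]big_seq [RHS]big_seq; apply: eq_bigr => u /ss' us'.
by rewrite integral_seq_mul_sum.
Qed.

(** This is membership in the ideal generated by all integral idempotents: by orthogonality, a sum
    of distinct ones fixes each of its terms. *)
Definition in_integral_sum x :=
  exists2 s, integral_seq s & x = x * \sum_(u <- s) u.

Fact in_integral_sum0 : in_integral_sum 0.
Proof. by exists [::]; rewrite ?mul0r. Qed.

Fact in_integral_sumD a x y :
  in_integral_sum x -> in_integral_sum y -> in_integral_sum (a * x + y).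
Proof.
move=> [s [us sP] xs] [t [ut tP] yt].
(* Repetitions are removed because an idempotent counted twice would not be fixed by the sum. *)
have stP : integral_seq (undup (s ++ t)).
  by split=> [|u]; rewrite ?undup_uniq // mem_undup mem_cat => /orP[/sP|/tP].
exists (undup (s ++ t)) => //.
rewrite mulrDl -mulrA -(integral_seq_fixed stP _ xs); last first.
  by move=> u us'; rewrite mem_undup mem_cat us'.
rewrite -(integral_seq_fixed stP _ yt) // => u ut'.
by rewrite mem_undup mem_cat ut' orbT.
Qed.

Definition integral_sum : ideal A :=
  ideal_of_prop in_integral_sum0 in_integral_sumD.

Lemma integral_sumP x : x \in integral_sum <-> in_integral_sum x.
Proof. exact: ideal_of_propP. Qed.

End IntegralIdempotents.

(** If the integral idempotents generated a proper ideal, it would lie in a prime [m]. The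
    idempotent [e] of [m] fixing its core makes [1 - e] integral, so [m] would contain both [e] and
    [1 - e]. *)
Lemma integral_decomposition (A : comPzRingType) (hA : semi_hereditary A)
    (hmin : forall p : ideal A, minimal_prime p -> finitely_generated p) :
  exists2 s : seq A, integral_seq s & \sum_(u <- s) u = 1.
Proof.
suff /integral_sumP[s sP s1] : 1 \in integral_sum A.
  by exists s; rewrite // [RHS]s1 mul1r.
apply: contrapT => /negP/prime_above[m mprime Jm].
have [e [em ee ecore]] := fg_core_idempotent (hmin _ (core_minimal_prime hA mprime)).
(* The core is the annihilator of [1 - e], so its primality is the integrality of [1 - e]. *)
have coreE x : (1 - e) * x = 0 <-> x \in core m.
  split=> [ex|/ecore xe]; last by rewrite mulrBl mul1r mulrC xe subrr.
  apply/coreP; exists e; split=> //.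
  by apply/eqP; rewrite -subr_eq0 -ex; apply/eqP; ring.
have uP : integral_idempotent (1 - e).
  split.
  - apply/eqP => e0; have := idealN1 mprime em.
    by rewrite e0 ideal0.
  - by transitivity (1 - e *+ 2 + e * e); [ring|rewrite ee; ring].
  - move=> x y /coreE xy; have [_ /(_ _ _ xy)] := core_prime hA mprime.
    by case=> /coreE; [left|right].
have /negP := idealN1 mprime em; apply; apply: Jm; apply/integral_sumP.
have [_ uu _] := uP.
exists [:: 1 - e]; last by rewrite big_seq1 uu.
by split=> // u; rewrite inE => /eqP->.
Qed.

(** * A criterion for Prüfer domains *)

Lemma fraction_quotient (D : idomainType) (z : {fraction D}) :
  exists a b : D, b != 0 /\ z = tofrac a / tofrac b.
Proof.
elim/quotW: z => r; exists (frac r).1, (frac r).2; split; first exact: denom_ratioP.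
have b0 : tofrac (frac r).2 != 0 by rewrite tofrac_eq0 denom_ratioP.
apply: (mulIf b0); rewrite divfK //.
(* With the denominator cleared, two classes of ratios are compared by cross multiplication. *)
rewrite -[LHS]/(FracField.mul _ _) !piE; apply/eqmodP; rewrite /= FracField.equivfE.
rewrite /FracField.mulf !numden_Ratio ?mulf_neq0 ?oner_neq0 ?denom_ratioP //.
by rewrite !mulr1 mulrC.
Qed.

Lemma prufer_criterion (D : idomainType) :
  (forall x y : D, x != 0 ->
     exists a b c d : D, [/\ a + d = 1, y * a = x * c & y * b = x * d]) ->
  prufer_domain D.
Proof.
move=> xyD p pprime; have [p1 pP] := pprime.
have pn0 s : s \notin p -> tofrac s != 0.
  by rewrite tofrac_eq0; apply: contraNneq => ->; apply: ideal0.
have pM s t : s \notin p -> t \notin p -> s * t \notin p.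
  by move=> /negP sp /negP tp; apply/negP => /pP[].
split; first split.
- by apply/asboolP; exists 1, 1; split=> //; rewrite divff // pn0.
- move=> _ _ /asboolP[a [s [sp ->]]] /asboolP[b [t [tp ->]]]; apply/asboolP.
  exists (a * t - b * s), (s * t); split; first exact: pM.
  by rewrite -mulNr addf_div ?pn0 // mulNr -!tofracM -tofracB.
- move=> _ _ /asboolP[a [s [sp ->]]] /asboolP[b [t [tp ->]]]; apply/asboolP.
  exists (a * b), (s * t); split; first exact: pM.
  by rewrite mulf_div -!tofracM.
move=> z; have [y [x [x0 ->]]] := fraction_quotient z.
rewrite mulf_eq0 invr_eq0 !tofrac_eq0 negb_or x0 andbT => y0.
have [a [b [c [d [ad ya yb]]]]] := xyD x y x0.
(* If [a] is in [p], then [d = 1 - a] is not, and the inverse of [z = y / x] is [b / d]; otherwise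
   [z = c / a]. *)
have [ap|ap] := boolP (a \in p).
  have dp : d \notin p.
    by have := idealN1 pprime ap; rewrite -ad addrC addKr.
  right; apply/asboolP; exists b, d; split=> //.
  apply/eqP; rewrite invfM invrK mulrC eqr_div ?(pn0 _ dp) ?tofrac_eq0 //.
  by rewrite -!tofracM tofrac_eq -yb mulrC.
left; apply/asboolP; exists c, a; split=> //.
by apply/eqP; rewrite eqr_div ?(pn0 _ ap) ?tofrac_eq0 // -!tofracM tofrac_eq ya mulrC.
Qed.

(** * The domain cut out by an integral idempotent *)

Section Corner.
Variables (A : comPzRingType) (u : A).
Hypothesis hu : integral_idempotent u.

(** The ideal [uA] is encoded as the fixed points of [u]; carrying the proof of integrality lets the
    type built on it bear the domain structure. *)
Definition in_corner of integral_idempotent u : {pred A} := fun x => u * x == x.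

Fact in_corner_zmod : zmod_closed (in_corner hu).
Proof.
split=> [|x y]; rewrite unfold_in ?mulr0 // => /eqP ux /eqP uy.
by rewrite unfold_in mulrBr ux uy.
Qed.

HB.instance Definition _ := GRing.isZmodClosed.Build A (in_corner hu) in_corner_zmod.

Definition corner : Type := {x : A | x \in in_corner hu}.
HB.instance Definition _ := SubChoice.on corner.
HB.instance Definition _ := [SubChoice_isSubZmodule of corner by <:].
Implicit Types x y z : corner.

Lemma in_cornerM (a : A) : u * a \in in_corner hu.
Proof. by have [_ uu _] := hu; rewrite unfold_in mulrA uu. Qed.

Definition to_corner (a : A) : corner := Sub (u * a) (in_cornerM a).

Lemma val_to_corner a : val (to_corner a) = u * a.
Proof. exact: SubK. Qed.

Lemma corner_fixed x : u * val x = val x.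
Proof. exact/eqP/(valP x). Qed.

Lemma valK_corner x : to_corner (val x) = x.
Proof. by apply: val_inj; rewrite val_to_corner corner_fixed. Qed.

Definition corner_mul x y := to_corner (val x * val y).

Lemma val_corner_mul x y : val (corner_mul x y) = val x * val y.
Proof. by rewrite val_to_corner mulrA corner_fixed. Qed.

Fact corner_mulA : associative corner_mul.
Proof. by move=> x y z; apply: val_inj; rewrite !val_corner_mul mulrA. Qed.

Fact corner_mulC : commutative corner_mul.
Proof. by move=> x y; apply: val_inj; rewrite !val_corner_mul mulrC. Qed.

Fact corner_mul1 : left_id (to_corner 1) corner_mul.
Proof.
by move=> x; apply: val_inj; rewrite val_corner_mul val_to_corner mulr1 corner_fixed.
Qed.

Fact corner_mulD : left_distributive corner_mul +%R.
Proof.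
move=> x y z; apply: val_inj.
transitivity ((val x + val y) * val z); first exact: val_corner_mul.
by rewrite mulrDl -!val_corner_mul.
Qed.

Fact corner1_neq0 : to_corner 1 != 0.
Proof.
have [u0 _ _] := hu; apply: contra u0 => /eqP/(congr1 val).
by rewrite val_to_corner mulr1 raddf0 => ->.
Qed.

HB.instance Definition _ := GRing.Zmodule_isComNzRing.Build corner
  corner_mulA corner_mulC corner_mul1 corner_mulD corner1_neq0.

Definition corner_unit : {pred corner} := fun x => `[< exists y, y * x = 1 >].

(** Inverses are chosen classically; a non-unit is its own default value. *)
Definition corner_inv x : corner :=
  if pselect (exists y, y * x = 1) is left e then projT1 (cid e) else x.

Fact corner_mulV : {in corner_unit, left_inverse 1 corner_inv *%R}.
Proof.
move=> x /asboolP ex; rewrite /corner_inv; case: pselect => // e.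
by case: (cid e).
Qed.

Fact corner_unitP x y : y * x = 1 -> corner_unit x.
Proof. by move=> xy; apply/asboolP; exists y. Qed.

Fact corner_inv_out : {in [predC corner_unit], corner_inv =1 id}.
Proof.
by move=> x /asboolP nx; rewrite /corner_inv; case: pselect.
Qed.

HB.instance Definition _ := GRing.ComNzRing_hasMulInverse.Build corner
  corner_mulV corner_unitP corner_inv_out.

Fact corner_integral : GRing.integral_domain_axiom corner.
Proof.
move=> x y /(congr1 val); rewrite raddf0 [LHS]val_corner_mul => xy.
have [_ _ /(_ (val x) (val y))] := hu; rewrite xy mulr0 !corner_fixed.
by case=> // e; apply/orP; [left|right]; apply/eqP/val_inj; rewrite e.
Qed.

HB.instance Definition _ := GRing.ComUnitRing_isIntegral.Build corner corner_integral.

Fact to_corner_zmod : zmod_morphism to_corner.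
Proof.
by move=> a b; apply: val_inj; rewrite raddfB /= mulrBr.
Qed.

Fact to_corner_monoid : monoid_morphism to_corner.
Proof.
split=> // a b; apply: val_inj; rewrite [RHS]val_corner_mul !val_to_corner.
by have [_ uu _] := hu; rewrite mulrACA uu.
Qed.

HB.instance Definition _ := GRing.isZmodMorphism.Build A corner to_corner to_corner_zmod.
HB.instance Definition _ := GRing.isMonoidMorphism.Build A corner to_corner to_corner_monoid.

(** The ideal generated by the two elements is split in [A] itself, so semi-heredity need not be
    transferred to the corner; the matrix entries are then projected by [u]. *)
Lemma corner_prufer : semi_hereditary A -> prufer_domain corner.
Proof.
move=> hA; apply: prufer_criterion => x y x0.
pose g (i : 'I_2) : A := if i == 0 then val x else val y.
have [c [gc cann]] := split_span hA g.
have g0 : g 0 = val x by [].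
have g1 : g 1 = val y by [].
have sum2 (F : 'I_2 -> A) : \sum_i F i = F 0 + F 1.
  by rewrite big_ord_recl big_ord1; congr (_ + F _); apply: val_inj.
(* This comes from the relation [(- y) * x + x * y = 0] between the generators. *)
have {}cann j : val y * c 0 j = val x * c 1 j.
  have := cann (fun i => if i == 0 then - val y else val x).
  rewrite !sum2 /= g0 g1 mulNr [val x * _]mulrC addNr => /(_ erefl j).
  by rewrite !sum2 /= mulNr addrC => /eqP; rewrite subr_eq0 => /eqP.
have xE : val x = c 0 0 * val x + c 0 1 * val y.
  by rewrite -[LHS]g0 gc sum2 g0 g1.
have proj a : x * to_corner a = to_corner (val x * a).
  by rewrite rmorphM /= valK_corner.
have proj' a : y * to_corner a = to_corner (val y * a).
  by rewrite rmorphM /= valK_corner.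
exists (to_corner (c 0 0)), (to_corner (c 0 1)), (to_corner (c 1 0)), (to_corner (c 1 1)).
split; last 2 first.
- by rewrite proj proj' cann.
- by rewrite proj proj' cann.
(* Here [x * (a + d) = a * x + b * y = x], using [x * d = y * b], and [x] cancels. *)
apply: (mulfI x0); rewrite -rmorphD mulr1 proj -[RHS]valK_corner [in RHS]xE.
by congr to_corner; rewrite mulrDr -cann; ring.
Qed.

End Corner.

(** * The product decomposition *)

Section CornerProduct.
Variables (A : comPzRingType) (n : nat) (u : 'I_n -> A).
Hypothesis hu : forall i, integral_idempotent (u i).
Hypothesis u_orth : forall i j, i != j -> u i * u j = 0.
Hypothesis u_sum : \sum_i u i = 1.

Local Notation prodD := {dffun forall i : 'I_n, corner (hu i)}.

Definition to_corners (a : A) : prodD := [ffun i => to_corner (hu i) a].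

Fact to_corners_zmod : zmod_morphism to_corners.
Proof. by move=> a b; apply/ffunP => i; rewrite !ffunE rmorphB. Qed.

Fact to_corners_monoid : monoid_morphism to_corners.
Proof.
by split=> [|a b]; apply/ffunP => i; rewrite !ffunE ?rmorph1 ?rmorphM.
Qed.

HB.instance Definition _ :=
  GRing.isZmodMorphism.Build A prodD to_corners to_corners_zmod.
HB.instance Definition _ :=
  GRing.isMonoidMorphism.Build A prodD to_corners to_corners_monoid.

Lemma to_corners_bij : bijective to_corners.
Proof.
(* Summing the components is a left inverse because the idempotents sum to 1, and a right inverse
   because they are orthogonal. *)
exists (fun y : prodD => \sum_i val (y i)) => [a|y].
  under eq_bigr do rewrite ffunE val_to_corner.
  by rewrite -mulr_suml u_sum mul1r.
apply/ffunP => i; rewrite ffunE; apply: val_inj.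
rewrite val_to_corner mulr_sumr (bigD1 i) //= corner_fixed big1 ?addr0 // => j ji.
by rewrite -corner_fixed mulrA u_orth ?mul0r // eq_sym.
Qed.

End CornerProduct.

Theorem corollary5p3 (A : comPzRingType) (hA : semi_hereditary A)
  (hmin : forall p : ideal A, minimal_prime p -> finitely_generated p) :
  exists (n : nat) (D : 'I_n -> idomainType),
    (forall i : 'I_n, prufer_domain (D i)) /\
    exists f : {rmorphism A -> {dffun forall i : 'I_n, D i}}, bijective f.
Proof.
have [s [us sP] s1] := integral_decomposition hA hmin.
pose u (i : 'I_(size s)) := s`_i.
have hu i : integral_idempotent (u i) by apply: sP; apply: mem_nth.
have u_orth i j : i != j -> u i * u j = 0.
  by move=> ij; apply: integral_idempotent_orthogonal => //; rewrite nth_uniq.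
have u_sum : \sum_i u i = 1 by rewrite -s1 (big_nth 0) big_mkord.
(* For the zero ring [s] is empty, since integral idempotents are nonzero, and the product is
   empty. *)
exists (size s), (fun i => corner (hu i)); split=> [i|].
  exact: corner_prufer.
by exists (to_corners hu); apply: to_corners_bij.
Qed.
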